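(* The collection of all $2$-term difference $A_\infty$-algebras and difference $A_\infty$-homomorphisms between them is a category. (This category is denoted $\mathsf{2TermDiffA}_\infty$.)
   Context: All vector spaces are over a field $\mathbf{k}$ of characteristic $0$. **2-term $A_\infty$-algebras.** A $2$-term $A_\infty$-algebra $\mathfrak{a}=(A_1\xrightarrow{\delta}A_0,\odot,\mu)$ consists of a $2$-term complex $A_1\xrightarrow{\delta}A_0$ (a linear map of vector spaces), bilinear maps $\odot:A_i\times A_j\to A_{i+j}$ ($0\le i+j\le1$) and a trilinear map $\mu:A_0\times A_0\times A_0\to A_1$ such that for all $x,y,z,t\in A_0$, $h,k\in A_1$: (A1) $\delta(x\odot h)=x\odot\delta(h)$; (A2) $\delta(h\odot x)=\delta(h)\odot x$; (A3) $\delta(h)\odot k=h\odot\delta(k)$; (A4) $x\odot(y\odot z)-(x\odot y)\odot z=\delta(\mu(x,y,z))$; (A5) $x\odot(y\odot h)-(x\odot y)\odot h=\mu(x,y,\delta(h))$; (A6) $x\odot(h\odot y)-(x\odot h)\odot y=\mu(x,\delta(h),y)$; (A7) $h\odot(x\odot y)-(h\odot x)\odot y=\mu(\delta(h),x,y)$; (A8) $x\odot\mu(y,z,t)-\mu(x\odot y,z,t)+\mu(x,y\odot z,t)-\mu(x,y,z\odot t)+\mu(x,y,z)\odot t=0$. An $A_\infty$-homomorphism $\mathfrak{a}\to\mathfrak{a}'=(A_1'\xrightarrow{\delta'}A_0',\odot',\mu')$ is a triple $(\varphi_0,\varphi_1,\varphi_2)$ with linear maps $\varphi_0:A_0\to A_0'$,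 $\varphi_1:A_1\to A_1'$ satisfying $\varphi_0\circ\delta=\delta'\circ\varphi_1$ and a bilinear map $\varphi_2:A_0\times A_0\to A_1'$ such that for all $x,y,z\in A_0$, $h\in A_1$: $\varphi_0(x\odot y)-\varphi_0(x)\odot'\varphi_0(y)=\delta'(\varphi_2(x,y))$; $\varphi_1(x\odot h)-\varphi_0(x)\odot'\varphi_1(h)=\varphi_2(x,\delta(h))$; $\varphi_1(h\odot x)-\varphi_1(h)\odot'\varphi_0(x)=\varphi_2(\delta(h),x)$; $\varphi_1(\mu(x,y,z))-\mu'(\varphi_0(x),\varphi_0(y),\varphi_0(z))=\varphi_2(x,y\odot z)-\varphi_2(x\odot y,z)+\varphi_0(x)\odot'\varphi_2(y,z)-\varphi_2(x,y)\odot'\varphi_0(z)$. **2-term difference $A_\infty$-algebras.** A difference operator on $\mathfrak{a}$ is a triple $\mathfrak{d}=(d_0,d_1,d_2)$ of linear maps $d_0:A_0\to A_0$, $d_1:A_1\to A_1$ with $d_0\circ\delta=\delta\circ d_1$ and a bilinear map $d_2:A_0\times A_0\to A_1$ such that for all $x,y,z\in A_0$, $h\in A_1$: (D1) $d_0(x)\odot y+x\odot d_0(y)+d_0(x)\odot d_0(y)-d_0(x\odot y)=\delta(d_2(x,y))$; (D2) $d_0(x)\odot h+x\odot d_1(h)+d_0(x)\odot d_1(h)-d_1(x\odot h)=d_2(x,\delta(h))$; (D3) $d_1(h)\odot x+h\odot d_0(x)+d_1(h)\odot d_0(x)-d_1(h\odot x)=d_2(\delta(h),x)$; (D4) $(x+d_0(x))\odot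 d_2(y,z)-d_2(x\odot y,z)+d_2(x,y\odot z)-d_2(x,y)\odot(z+d_0(z))=\mu(d_0(x),y,z)+\mu(x,d_0(y),z)+\mu(x,y,d_0(z))+\mu(d_0(x),d_0(y),z)+\mu(d_0(x),y,d_0(z))+\mu(x,d_0(y),d_0(z))+\mu(d_0(x),d_0(y),d_0(z))-d_1(\mu(x,y,z))$. The pair $(\mathfrak{a},\mathfrak{d})$ is a $2$-term difference $A_\infty$-algebra. A difference $A_\infty$-homomorphism $(\mathfrak{a},\mathfrak{d})\to(\mathfrak{a}',\mathfrak{d}')$, with $\mathfrak{d}'=(d_0',d_1',d_2')$, is a quadruple $\varphi=(\varphi_0,\varphi_1,\varphi_2,\varphi_3)$ where $(\varphi_0,\varphi_1,\varphi_2):\mathfrak{a}\to\mathfrak{a}'$ is an $A_\infty$-homomorphism and $\varphi_3:A_0\to A_1'$ is a linear map such that for all $x,y\in A_0$, $h\in A_1$: $\varphi_0(d_0(x))-d_0'(\varphi_0(x))=\delta'(\varphi_3(x))$; $\varphi_1(d_1(h))-d_1'(\varphi_1(h))=\varphi_3(\delta(h))$; $\varphi_1(d_2(x,y))-d_2'(\varphi_0(x),\varphi_0(y))=\{\varphi_2(d_0(x),y)+\varphi_2(x,d_0(y))+\varphi_2(d_0(x),d_0(y))-\varphi_3(x\odot y)\}+\{\varphi_3(x)\odot'\varphi_0(y)+\varphi_0(x)\odot'\varphi_3(y)-d_1'(\varphi_2(x,y))\}$. **Composition and identities.** For $\varphi:(\mathfrak{a},\mathfrak{d})\to(\mathfrak{a}',\mathfrak{d}')$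 and $\psi:(\mathfrak{a}',\mathfrak{d}')\to(\mathfrak{a}'',\mathfrak{d}'')$: $(\psi\circ\varphi)_0=\psi_0\circ\varphi_0$, $(\psi\circ\varphi)_1=\psi_1\circ\varphi_1$, $(\psi\circ\varphi)_2(x,y)=\psi_2(\varphi_0(x),\varphi_0(y))+\psi_1(\varphi_2(x,y))$, $(\psi\circ\varphi)_3(x)=\psi_3(\varphi_0(x))+\psi_1(\varphi_3(x))$. The identity of $(\mathfrak{a},\mathfrak{d})$ is $(\mathrm{Id}_{A_0},\mathrm{Id}_{A_1},0,0)$.
   Formalization: In the last condition on a difference A∞-homomorphism, the terms φ₃(x)⊙'φ₀(d₀(y)) and d₀'(φ₀(x))⊙'φ₃(y) are added to the right-hand side; with the formula as printed, such homomorphisms are not closed under composition. *)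

(* Defs.v *)
From mathcomp Require Import all_boot all_order all_algebra.
Set Implicit Arguments.
Unset Strict Implicit.
Unset Printing Implicit Defensive.
Import GRing.Theory.
Local Open Scope ring_scope.

Reserved Notation "x ⊙ y" (at level 40, left associativity).
Reserved Notation "x ⊙> h" (at level 40, left associativity).
Reserved Notation "h <⊙ x" (at level 40, left associativity).

Record ainf_data (k : fieldType) := AinfData {
  A0 : lmodType k;
  A1 : lmodType k;
  delta : {linear A1 -> A0};
  m00 : {bilinear A0 -> A0 -> A0};
  m01 : {bilinear A0 -> A1 -> A1};
  m10 : {bilinear A1 -> A0 -> A1};
  mu : A0 -> A0 -> A0 -> A1
}.
Arguments delta {k a}.
Arguments m00 {k a}.
Arguments m01 {k a}.
Arguments m10 {k a}.
Arguments mu {k a}.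

(* The three components of the product: A0 x A0 -> A0, A0 x A1 -> A1 and
   A1 x A0 -> A1; the angle bracket points to the factor lying in A1. *)
Notation "x ⊙ y" := (m00 x y) : ring_scope.
Notation "x ⊙> h" := (m01 x h) : ring_scope.
Notation "h <⊙ x" := (m10 h x) : ring_scope.

Definition trilinear (k : fieldType) (U V W Z : lmodType k)
    (f : U -> V -> W -> Z) : Prop :=
  [/\ forall y z, linear (fun x => f x y z),
      forall x z, linear (fun y => f x y z) &
      forall x y, linear (fun z => f x y z)].

Record is_ainf (k : fieldType) (a : ainf_data k) : Prop := IsAinf {
  mu_trilinear : trilinear (@mu k a);
  ainf_delta_m01 : forall (x : A0 a) (h : A1 a),
    delta (x ⊙> h) = x ⊙ delta h;
  ainf_delta_m10 : forall (x : A0 a) (h : A1 a),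
    delta (h <⊙ x) = delta h ⊙ x;
  ainf_delta_swap : forall h l : A1 a, delta h ⊙> l = h <⊙ delta l;
  ainf_assoc000 : forall x y z : A0 a,
    x ⊙ (y ⊙ z) - (x ⊙ y) ⊙ z = delta (mu x y z);
  ainf_assoc001 : forall (x y : A0 a) (h : A1 a),
    x ⊙> (y ⊙> h) - (x ⊙ y) ⊙> h = mu x y (delta h);
  ainf_assoc010 : forall (x y : A0 a) (h : A1 a),
    x ⊙> (h <⊙ y) - (x ⊙> h) <⊙ y = mu x (delta h) y;
  ainf_assoc100 : forall (x y : A0 a) (h : A1 a),
    h <⊙ (x ⊙ y) - (h <⊙ x) <⊙ y = mu (delta h) x y;
  ainf_mu_cocycle : forall x y z t : A0 a,
    x ⊙> mu y z t - mu (x ⊙ y) z t + mu x (y ⊙ z) t - mu x y (z ⊙ t)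
      + mu x y z <⊙ t = 0
}.

Record ainf (k : fieldType) := Ainf {
  ainf_base :> ainf_data k;
  ainfP : is_ainf ainf_base
}.

Record diff_op_data (k : fieldType) (a : ainf_data k) := DiffOpData {
  d0 : {linear A0 a -> A0 a};
  d1 : {linear A1 a -> A1 a};
  d2 : {bilinear A0 a -> A0 a -> A1 a}
}.

Record is_diff_op (k : fieldType) (a : ainf_data k) (d : diff_op_data a)
    : Prop := IsDiffOp {
  diff_op_delta : forall h, d0 d (delta h) = delta (d1 d h);
  diff_op_m00 : forall x y : A0 a,
    d0 d x ⊙ y + x ⊙ d0 d y + d0 d x ⊙ d0 d y - d0 d (x ⊙ y)
      = delta (d2 d x y);
  diff_op_m01 : forall (x : A0 a) (h : A1 a),
    d0 d x ⊙> h + x ⊙> d1 d h + d0 d x ⊙> d1 d h - d1 d (x ⊙> h)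
      = d2 d x (delta h);
  diff_op_m10 : forall (x : A0 a) (h : A1 a),
    d1 d h <⊙ x + h <⊙ d0 d x + d1 d h <⊙ d0 d x - d1 d (h <⊙ x)
      = d2 d (delta h) x;
  diff_op_mu : forall x y z : A0 a,
    (x + d0 d x) ⊙> d2 d y z - d2 d (x ⊙ y) z + d2 d x (y ⊙ z)
      - d2 d x y <⊙ (z + d0 d z)
    = mu (d0 d x) y z + mu x (d0 d y) z + mu x y (d0 d z)
      + mu (d0 d x) (d0 d y) z + mu (d0 d x) y (d0 d z)
      + mu x (d0 d y) (d0 d z) + mu (d0 d x) (d0 d y) (d0 d z)
      - d1 d (mu x y z)
}.

Record diff_ainf (k : fieldType) := DiffAinf {
  diff_base :> ainf k;
  diff_op :> diff_op_data diff_base;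
  diff_opP : is_diff_op diff_op
}.

Record ainf_hom_data (k : fieldType) (a b : ainf_data k) := AinfHomData {
  phi0 : {linear A0 a -> A0 b};
  phi1 : {linear A1 a -> A1 b};
  phi2 : {bilinear A0 a -> A0 a -> A1 b}
}.

Record is_ainf_hom (k : fieldType) (a b : ainf_data k)
    (f : ainf_hom_data a b) : Prop := IsAinfHom {
  ainf_hom_delta : forall h, phi0 f (delta h) = delta (phi1 f h);
  ainf_hom_m00 : forall x y : A0 a,
    phi0 f (x ⊙ y) - phi0 f x ⊙ phi0 f y = delta (phi2 f x y);
  ainf_hom_m01 : forall (x : A0 a) (h : A1 a),
    phi1 f (x ⊙> h) - phi0 f x ⊙> phi1 f h = phi2 f x (delta h);
  ainf_hom_m10 : forall (x : A0 a) (h : A1 a),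
    phi1 f (h <⊙ x) - phi1 f h <⊙ phi0 f x = phi2 f (delta h) x;
  ainf_hom_mu : forall x y z : A0 a,
    phi1 f (mu x y z) - mu (phi0 f x) (phi0 f y) (phi0 f z)
    = phi2 f x (y ⊙ z) - phi2 f (x ⊙ y) z + phi0 f x ⊙> phi2 f y z
      - phi2 f x y <⊙ phi0 f z
}.

Record diff_hom_data (k : fieldType) (a b : diff_ainf k) := DiffHomData {
  diff_hom_ainf :> ainf_hom_data a b;
  phi3 : {linear A0 a -> A1 b}
}.

(* phi3 is a homotopy between phi \o (1 + d) and (1 + d') \o phi, hence in
   diff_hom_d2 it multiplies phi0 (y + d0 y) and phi0 x + d0' (phi0 x).  This
   departs from the source, which prints only phi3 x <⊙ phi0 y and
   phi0 x ⊙> phi3 y and omits the two terms phi3 x <⊙ phi0 (d0 y) and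
   d0' (phi0 x) ⊙> phi3 y: without them the morphisms are not closed under
   composition.  Since (delta h) ⊙> l = h <⊙ (delta l), the sum of these two
   terms also equals phi3 x <⊙ d0' (phi0 y) + phi0 (d0 x) ⊙> phi3 y. *)
Record is_diff_hom (k : fieldType) (a b : diff_ainf k)
    (f : diff_hom_data a b) : Prop := IsDiffHom {
  diff_hom_ainfP : is_ainf_hom f;
  diff_hom_d0 : forall x,
    phi0 f (d0 a x) - d0 b (phi0 f x) = delta (phi3 f x);
  diff_hom_d1 : forall h,
    phi1 f (d1 a h) - d1 b (phi1 f h) = phi3 f (delta h);
  diff_hom_d2 : forall x y : A0 a,
    phi1 f (d2 a x y) - d2 b (phi0 f x) (phi0 f y)
    = (phi2 f (d0 a x) y + phi2 f x (d0 a y) + phi2 f (d0 a x) (d0 a y)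
         - phi3 f (x ⊙ y))
      + (phi3 f x <⊙ phi0 f (y + d0 a y)
         + (phi0 f x + d0 b (phi0 f x)) ⊙> phi3 f y
         - d1 b (phi2 f x y))
}.

Record diff_hom (k : fieldType) (a b : diff_ainf k) := DiffHom {
  diff_hom_base :> diff_hom_data a b;
  diff_homP : is_diff_hom diff_hom_base
}.

Definition is_identity (k : fieldType) (a : diff_ainf k) (f : diff_hom a a)
    : Prop :=
  [/\ forall x, phi0 f x = x, forall h, phi1 f h = h,
      forall x y, phi2 f x y = 0 & forall x, phi3 f x = 0].

Definition is_composite (k : fieldType) (a b c : diff_ainf k)
    (g : diff_hom b c) (f : diff_hom a b) (gf : diff_hom a c) : Prop :=
  [/\ forall x, phi0 gf x = phi0 g (phi0 f x),
      forall h, phi1 gf h = phi1 g (phi1 f h),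
      forall x y,
        phi2 gf x y = phi2 g (phi0 f x) (phi0 f y) + phi1 g (phi2 f x y) &
      forall x, phi3 gf x = phi3 g (phi0 f x) + phi1 g (phi3 f x)].

Record is_category (Ob : Type) (Hom : Ob -> Ob -> Type)
    (idm : forall X, Hom X X)
    (comp : forall X Y Z, Hom Y Z -> Hom X Y -> Hom X Z) : Prop := IsCategory {
  cat_idl : forall X Y (f : Hom X Y), comp X Y Y (idm Y) f = f;
  cat_idr : forall X Y (f : Hom X Y), comp X X Y f (idm X) = f;
  cat_assoc : forall X Y Z T (h : Hom Z T) (g : Hom Y Z) (f : Hom X Y),
    comp X Z T h (comp X Y Z g f) = comp X Y T (comp Y Z T h g) f
}.

(* Main.v *)
Require Import Defs.
From mathcomp Require Import all_boot all_order all_algebra.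
From HB Require Import structures.
From mathcomp Require Import boolp ring.
Set Implicit Arguments.
Unset Strict Implicit.
Unset Printing Implicit Defensive.
Import GRing.Theory.
Local Open Scope ring_scope.

(** Associativity and the unit laws are immediate on the four components of a
    morphism; the substance is that composites are morphisms again.

    Put D = 1 + d.  The axioms of a difference operator say exactly that
    (1 + d0, 1 + d1, - d2) is an A-infinity endomorphism of a.  The axioms
    relating phi3 to (phi0, phi1, phi2) say that phi3 is a homotopy from
    phi \o D to D' \o phi.  A difference morphism is thus a square of
    A-infinity homomorphisms that commutes up to a given homotopy, and
    composing two of them means pasting the squares:
      psi \o phi \o D  ~  psi \o D' \o phi  ~  D'' \o psi \o phi,
    where the first homotopy is psi1 \o phi3 and the second is psi3 \o phi0.
    This is why their sum is the fourth component of the composite.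

    The verification ([ainf_compP], [diff_hom_compP]) is written out in
    components.  The axioms of psi, evaluated at phi0 x and phi0 y, are added to
    the image under psi1 of the axioms of phi.  The two do not match literally,
    since phi0 preserves products only up to delta (phi2 x y), and
    commutes with d0 only up to delta (phi3 x); the axioms of psi with an
    argument in the image of delta turn these defects into the missing terms.
    Vertical pasting of homotopies needs in addition that A1 is a strict
    bimodule along delta, that is (delta h) ⊙> l = h <⊙ (delta l).  What is
    left each time is an identity of signed sums, closed by [module_ring]. *)

(** * Additive identities in a module *)

(** The square-zero extension of k by V, in which V is an ideal with trivial
    product.  As it is a commutative ring containing V, identities between
    sums and differences of vectors can be decided by the ring normaliser. *)
Definition sqzero_ext (k : fieldType) (V : lmodType k) : Type := (k * V)%type.

Section SquareZeroExtension.
Variables (k : fieldType) (V : lmodType k).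
Local Notation E := (sqzero_ext V).
Implicit Types p q r : E.

HB.instance Definition _ := GRing.Zmodule.on E.

Definition sqzero_one : E := (1, 0).
Definition sqzero_mul p q : E := (p.1 * q.1, p.1 *: q.2 + q.1 *: p.2).

Lemma sqzero_mulA : associative sqzero_mul.
Proof.
move=> [a u] [b v] [c w]; congr (_, _); rewrite /= ?mulrA //.
by rewrite !scalerDr !scalerA !addrA (mulrC c a) (mulrC c b).
Qed.

Lemma sqzero_mulC : commutative sqzero_mul.
Proof. by move=> [a u] [b v]; rewrite /sqzero_mul /= mulrC addrC. Qed.

Lemma sqzero_mul1 : left_id sqzero_one sqzero_mul.
Proof. by move=> [a u]; rewrite /sqzero_mul /= mul1r scale1r scaler0 addr0. Qed.

Lemma sqzero_mulD : left_distributive sqzero_mul +%R.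
Proof.
move=> [a u] [b v] [c w]; congr (_, _); rewrite /= ?mulrDl //.
by rewrite scalerDl scalerDr addrACA.
Qed.

Lemma sqzero_one_neq0 : sqzero_one != 0.
Proof. by apply/eqP => -[/eqP]; rewrite oner_eq0. Qed.

HB.instance Definition _ := GRing.Zmodule_isComNzRing.Build E
  sqzero_mulA sqzero_mulC sqzero_mul1 sqzero_mulD sqzero_one_neq0.

Definition sqzero_in (v : V) : E := (0, v).

Lemma sqzero_in_is_zmod_morphism : zmod_morphism sqzero_in.
Proof. by move=> u v; congr (_, _); rewrite /= subr0. Qed.

HB.instance Definition _ :=
  GRing.isZmodMorphism.Build V E sqzero_in sqzero_in_is_zmod_morphism.

Lemma sqzero_in_inj : injective sqzero_in.
Proof. by move=> u v []. Qed.

End SquareZeroExtension.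

Ltac module_ring := apply: sqzero_in_inj; ring.

(** * Extensionality of morphisms *)

Section Extensionality.
Variable k : fieldType.

Lemma linear_ext (U V : lmodType k) (f g : {linear U -> V}) :
  f =1 g -> f = g.
Proof.
case: f g => [f [[fD] [fZ]]] [g [[gD] [gZ]]] /= /funext fg.
case: g / fg in gD gZ *.
by rewrite (Prop_irrelevance fD gD) (Prop_irrelevance fZ gZ).
Qed.

Lemma bilinear_ext (U V W : lmodType k) (f g : {bilinear U -> V -> W}) :
  f =2 g -> f = g.
Proof.
case: f g => [f [[f1 f2 f3 f4]]] [g [[g1 g2 g3 g4]]] /= fg.
have {}fg : f = g by apply/funext => x; apply/funext => y; exact: fg.
case: g / fg in g1 g2 g3 g4 *.
by rewrite (Prop_irrelevance f1 g1) (Prop_irrelevance f2 g2)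
  (Prop_irrelevance f3 g3) (Prop_irrelevance f4 g4).
Qed.

(** The category laws are equalities of records containing proofs; this
    reduces them to pointwise equalities of vectors. *)
Lemma diff_hom_ext (a b : diff_ainf k) (f g : diff_hom a b) :
  phi0 f =1 phi0 g -> phi1 f =1 phi1 g ->
  phi2 f =2 phi2 g -> phi3 f =1 phi3 g -> f = g.
Proof.
case: f g => [[[f0 f1 f2] f3] fP] [[[g0 g1 g2] g3] gP] /=.
move=> /linear_ext e0 /linear_ext e1 /bilinear_ext e2 /linear_ext e3.
case: _ / e0 in gP *; case: _ / e1 in gP *.
case: _ / e2 in gP *; case: _ / e3 in gP *.
by rewrite (Prop_irrelevance fP gP).
Qed.

End Extensionality.

(** * Identity morphisms *)

Section Identity.
Variable k : fieldType.

Definition bilinear_zero (U V W : lmodType k) (x : U) (y : V) : W := 0.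

Lemma bilinear_zero_is_bilinear (U V W : lmodType k) :
  bilinear_for *:%R *:%R (@bilinear_zero U V W).
Proof. by split=> ? ? ? ?; rewrite /bilinear_zero /= scaler0 addr0. Qed.

HB.instance Definition _ (U V W : lmodType k) :=
  bilinear_isBilinear.Build k U V W *:%R *:%R (@bilinear_zero U V W)
    (@bilinear_zero_is_bilinear U V W).

Definition ainf_id_data (a : ainf_data k) : ainf_hom_data a a :=
  AinfHomData idfun idfun (@bilinear_zero (A0 a) (A0 a) (A1 a)).

Definition diff_hom_id_data (a : diff_ainf k) : diff_hom_data a a :=
  @DiffHomData k a a (ainf_id_data a) \0.

Lemma ainf_idP (a : ainf_data k) : is_ainf_hom (ainf_id_data a).
Proof.
by split=> * //=; rewrite /bilinear_zero ?linear0 ?linear0l ?subrr ?subr0 ?addr0.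
Qed.

Lemma diff_hom_idP (a : diff_ainf k) : is_diff_hom (diff_hom_id_data a).
Proof.
split=> [|x|h|x y] /=; first exact: ainf_idP.
- by rewrite subrr linear0.
- by rewrite subrr.
- by rewrite /bilinear_zero !linear0 linear0l !subrr !addr0.
Qed.

Definition diff_hom_id (a : diff_ainf k) : diff_hom a a :=
  DiffHom (diff_hom_idP a).

End Identity.

(** * Composites of A-infinity homomorphisms *)

(** The product axiom as a rewriting rule: it moves phi0 inside products, which
    is how composites are brought to the normal form used below. *)
Lemma phi0_m00 (k : fieldType) (a b : ainf_data k) (f : ainf_hom_data a b) :
  is_ainf_hom f ->
  forall x y, phi0 f (x ⊙ y) = phi0 f x ⊙ phi0 f y + delta (phi2 f x y).
Proof. by move=> fP x y; rewrite -(ainf_hom_m00 fP) addrC subrK. Qed.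

Section AinfComposition.
Variables (k : fieldType) (a b c : ainf_data k).
Variables (g : ainf_hom_data b c) (f : ainf_hom_data a b).

Definition comp_phi2 (x y : A0 a) : A1 c :=
  phi2 g (phi0 f x) (phi0 f y) + phi1 g (phi2 f x y).

Lemma comp_phi2_is_bilinear : bilinear_for *:%R *:%R comp_phi2.
Proof.
split=> z r x y; rewrite /comp_phi2.
  by rewrite linearP linearPl [phi2 f _ _]linearPl linearP /= scalerDr addrACA.
by rewrite !linearP /= scalerDr addrACA.
Qed.

HB.instance Definition _ :=
  bilinear_isBilinear.Build k (A0 a) (A0 a) (A1 c) *:%R *:%R comp_phi2
    comp_phi2_is_bilinear.

Definition ainf_comp_data : ainf_hom_data a c :=
  AinfHomData (phi0 g \o phi0 f) (phi1 g \o phi1 f) comp_phi2.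

(** In the axiom for mu, the values of phi2 g at phi0 f (y ⊙ z) and
    phi0 f (x ⊙ y) exceed those in the axiom of g by
    phi2 g (phi0 f x) (delta (phi2 f y z)) and its mirror image; the module
    axioms of g convert these into the failure of phi1 g to commute with the
    actions of phi0 f x and phi0 f z, which is what applying phi1 g to the
    axiom of f requires. *)
Lemma ainf_compP :
  is_ainf_hom g -> is_ainf_hom f -> is_ainf_hom ainf_comp_data.
Proof.
move=> gP fP; split=> [h|x y|x h|x h|x y z] /=; rewrite /comp_phi2.
- by rewrite (ainf_hom_delta fP) (ainf_hom_delta gP).
- rewrite (phi0_m00 fP) linearD (phi0_m00 gP) (ainf_hom_delta gP) linearD.
  module_ring.
- rewrite -(ainf_hom_m01 fP) (ainf_hom_delta fP) -(ainf_hom_m01 gP) linearB.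
  module_ring.
- rewrite -(ainf_hom_m10 fP) (ainf_hom_delta fP) -(ainf_hom_m10 gP) linearB.
  module_ring.
- have := congr1 (phi1 g) (ainf_hom_mu fP x y z).
  have := ainf_hom_mu gP (phi0 f x) (phi0 f y) (phi0 f z).
  rewrite !(phi0_m00 fP) !linearDl !linearDr.
  rewrite -(ainf_hom_m01 gP) -(ainf_hom_m10 gP).
  rewrite ![phi1 g (_ + _)]linearD ![phi1 g (- _)]linearN /=.
  move=> /(canRL (subrK _)) mu_g /(canRL (subrK _)) ->; rewrite mu_g.
  module_ring.
Qed.

End AinfComposition.

(** * Composites of difference homomorphisms *)

Lemma phi0_d0 (k : fieldType) (a b : diff_ainf k) (f : diff_hom_data a b) :
  is_diff_hom f ->
  forall x, phi0 f (d0 a x) = d0 b (phi0 f x) + delta (phi3 f x).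
Proof. by move=> fP x; rewrite -(diff_hom_d0 fP) addrC subrK. Qed.

Section DiffComposition.
Variables (k : fieldType) (a b c : diff_ainf k).

Definition diff_hom_comp_data (g : diff_hom_data b c) (f : diff_hom_data a b) :
    diff_hom_data a c :=
  @DiffHomData k a c (ainf_comp_data g f)
    ((phi3 g \o phi0 f) \+ (phi1 g \o phi3 f)).

(** Pasting of homotopies.  The strategy in the last axiom is to express both
    sides through phi0 f x, phi0 f y and their images under g, pushing every
    occurrence of d0 outwards past phi0; the corrections this creates all lie
    in the image of delta, where the axioms of g evaluate them. *)
Lemma diff_hom_compP (g : diff_hom_data b c) (f : diff_hom_data a b) :
  is_diff_hom g -> is_diff_hom f -> is_diff_hom (diff_hom_comp_data g f).
Proof.
move=> gP fP; have gA := diff_hom_ainfP gP; have fA := diff_hom_ainfP fP.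
split=> [|x|h|x y] /=; first exact: ainf_compP.
- rewrite (phi0_d0 fP) linearD (phi0_d0 gP) (ainf_hom_delta gA) linearD.
  module_ring.
- rewrite -(diff_hom_d1 fP) (ainf_hom_delta fA) -(diff_hom_d1 gP) linearB.
  module_ring.
- have := congr1 (phi1 g) (diff_hom_d2 fP x y).
  have := diff_hom_d2 gP (phi0 f x) (phi0 f y).
  rewrite /comp_phi2 /= !(linearDr, linearD, linearN) /=.
  rewrite !(phi0_d0 fP, phi0_m00 fA) !(linearDr, linearDl, linearD) /=.
  (* Evaluate phi2 g and phi3 g wherever an argument is in the image of delta;
     only then may phi0 g be moved past d0, as these evaluations create new
     terms phi0 g (d0 b _). *)
  rewrite -!(diff_hom_d1 gP, ainf_hom_m01 gA, ainf_hom_m10 gA).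
  rewrite !(phi0_d0 gP, ainf_hom_delta gA).
  rewrite !(linearDr, linearDl, linearD) /=.
  move=> /(canRL (subrK _)) d2_g /(canRL (subrK _)) ->; rewrite d2_g.
  (* The cross terms of the two homotopies, with phi3 g (phi0 f x) on one side
     and phi1 g (phi3 f y) on the other, agree only up to this exchange. *)
  rewrite !(ainf_delta_swap (ainfP _)).
  module_ring.
Qed.

End DiffComposition.

(** * The category *)

Theorem theorem4p9 (k : fieldType) (hk : [pchar k]%R =i pred0) :
  exists (idm : forall a : diff_ainf k, diff_hom a a)
         (comp : forall a b c : diff_ainf k,
            diff_hom b c -> diff_hom a b -> diff_hom a c),
    [/\ forall a, is_identity (idm a),
        forall a b c (g : diff_hom b c) (f : diff_hom a b),
          is_composite g f (comp a b c g f) &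
        is_category idm comp].
Proof.
exists (@diff_hom_id k).
exists (fun a b c g f => DiffHom (diff_hom_compP (diff_homP g) (diff_homP f))).
split=> [a|a b c g f|]; [by split | by split |].
split=> [a b f|a b f|a b c d h g f]; apply: diff_hom_ext => //=.
- by move=> x y; rewrite /comp_phi2 /bilinear_zero add0r.
- by move=> x; rewrite /= add0r.
- by move=> x y; rewrite /comp_phi2 /= linear0 addr0.
- by move=> x; rewrite /= linear0 addr0.
- by move=> x y; rewrite /comp_phi2 /= /comp_phi2 linearD addrA.
- by move=> x; rewrite /= linearD addrA.
Qed.
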